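(* Let $p\ge2$ and consider a lasso with normalized data in dimension $p$. If a segment of the lasso solution belongs to one of the coordinate axes of $\mathbb R^p$, then (with its endpoints) it contains the origin. Thus such a segment is unique in a solution, if it exists.
   Context: A data set consists of $N$ points $(x_1^{(i)},\dots,x_p^{(i)},y^{(i)})\in\mathbb R^{p+1}$ with centroid at the origin and not contained in any proper affine subspace (full rank assumption). Put $K=\frac1N\sum_i x^{(i)}(x^{(i)})^T$ (the $p\times p$ covariance matrix of the predictors, which is positive definite), $b=\frac1N\sum_i y^{(i)}x^{(i)}\in\mathbb R^p$, $\hat\beta=K^{-1}b$, $\hat t=\sum_j|\hat\beta_j|$. The data are normalized if $K_{jj}=1$ for all $j=1,\dots,p$. For $t\ge0$ the lasso estimate $\beta(t)$ is the unique minimizer of $f(\beta)=\frac12\sum_i\big(y^{(i)}-\sum_j\beta_jx_j^{(i)}\big)^2$ over $\beta\in\mathbb R^p$ with $\sum_j|\beta_j|\le t$. The lasso solution (path) is the curve $t\mapsto\beta(t)$, $0\le t\le\hat t$, a polygonal chain from $\hat\beta$ to the origin. Its segments (of positive length) are the maximal portions along which the sign vector $(\operatorname{sgn}\beta_1,\dots,\operatorname{sgn}\beta_p)\in\{-1,0,1\}^p$ is constant. *)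

(* Defs.v *)
From HB Require Import structures.
From mathcomp Require Import all_boot all_order all_algebra.
From mathcomp Require Import all_classical all_reals all_analysis.
Import Order.TTheory GRing.Theory Num.Theory.
Import numFieldNormedType.Exports.

Set Implicit Arguments.
Unset Strict Implicit.
Unset Printing Implicit Defensive.

Local Open Scope classical_set_scope.
Local Open Scope ring_scope.

Section Lasso.
Context {R : realType} {N p : nat}.

(* The i-th data point is (x i, y i), read in R^(p+1) as [data_point x y i]. *)
Implicit Types (x : 'I_N -> 'cV[R]_p) (y : 'I_N -> R).

Definition data_point x y (i : 'I_N) : 'cV[R]_(p + 1) :=
  col_mx (x i) (y i)%:M.

Definition centered x y : Prop :=
  N%:R^-1 *: \sum_(i < N) data_point x y i = 0.

(* a + V is a proper affine subspace exactly when V != fullv; the condition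
   fails for N = 0, so that it implies 0 < N. *)
Definition full_rank x y : Prop :=
  ~ exists (a : 'cV[R]_(p + 1)) (V : {vspace 'cV[R]_(p + 1)}),
      V != fullv /\ forall i, data_point x y i - a \in V.

Definition covariance x : 'M[R]_p :=
  N%:R^-1 *: \sum_(i < N) x i *m (x i)^T.

Definition response_covariance x y : 'cV[R]_p :=
  N%:R^-1 *: \sum_(i < N) y i *: x i.

Definition normalized x : Prop := forall j, covariance x j j = 1.

Definition l1norm (v : 'cV[R]_p) : R := \sum_(j < p) `|v j 0|.

Definition beta_hat x y : 'cV[R]_p :=
  invmx (covariance x) *m response_covariance x y.

Definition t_hat x y : R := l1norm (beta_hat x y).

Definition lasso_loss x y (v : 'cV[R]_p) : R :=
  2^-1 * \sum_(i < N) (y i - \sum_(j < p) v j 0 * x i j 0) ^+ 2.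

Definition lasso_estimate x y (t : R) (v : 'cV[R]_p) : Prop :=
  l1norm v <= t /\
  forall w, l1norm w <= t -> lasso_loss x y v <= lasso_loss x y w.

(* Uniqueness of the minimizer is not part of the definition: it follows from
   [full_rank]. *)
Definition lasso_path x y (beta : R -> 'cV[R]_p) : Prop :=
  forall t, 0 <= t <= t_hat x y -> lasso_estimate x y t (beta t).

Definition sign_vector (v : 'cV[R]_p) : 'cV[R]_p := map_mx Num.sg v.

Definition constant_sign_portion x y (beta : R -> 'cV[R]_p) (I : set R) :
    Prop :=
  [/\ I `<=` [set` `[0, t_hat x y]], is_interval I
    & forall s t, I s -> I t -> sign_vector (beta s) = sign_vector (beta t)].

(* A segment is a set of points of R^p; it may or may not contain its
   endpoints, which are recovered by taking the closure. The last clause is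
   positivity of the length. *)
Definition lasso_segment x y (beta : R -> 'cV[R]_p) (S : set 'cV[R]_p) :
    Prop :=
  exists I : set R,
    [/\ constant_sign_portion x y beta I,
        forall J, constant_sign_portion x y beta J -> I `<=` J -> J = I,
        S = beta @` I
      & exists u v, [/\ S u, S v & u <> v]].

Definition coordinate_axis (j : 'I_p) : set 'cV[R]_p :=
  [set v | forall k, k != j -> v k 0 = 0].

Definition on_coordinate_axis (S : set 'cV[R]_p) : Prop :=
  exists j, S `<=` coordinate_axis j.

End Lasso.

(* Main.v *)
(* A point v = t s e_j with s = +-1 and t > 0 minimizes the loss over the l1 ball
   of radius t exactly when |r_k| <= s r_j for all k, where r = N (b - K v) is
   the score, i.e. minus the gradient of the loss. Since K_jj = 1 and
   |K_jk| <= 1, decreasing t raises s r_j at least as much as any |r_k|, so the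
   condition passes from t0 to all t <= t0: once the path meets an axis, it
   follows that axis down to the origin. Maximality of a segment then forces it
   to contain the parameters in ]0, t0], and two such segments overlap. *)
Require Import Defs.
From HB Require Import structures.
From mathcomp Require Import all_boot all_order all_algebra.
From mathcomp Require Import all_classical all_reals all_analysis.
From mathcomp Require Import ring lra.
Import Order.TTheory GRing.Theory Num.Theory.
Import numFieldNormedType.Exports.

Local Open Scope classical_set_scope.
Local Open Scope ring_scope.

Section LassoTheory.
Local Set Implicit Arguments.
Local Unset Strict Implicit.
Local Unset Printing Implicit Defensive.

Context {R : realType} {N p : nat}.
Implicit Types (x : 'I_N -> 'cV[R]_p) (y : 'I_N -> R) (v d : 'cV[R]_p).

(** * Fitted values, score, and expansion of the loss *)

Definition fit x v (i : 'I_N) : R := \sum_(j < p) v j 0 * x i j 0.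

Definition score x y v (k : 'I_p) : R :=
  \sum_(i < N) (y i - fit x v i) * x i k 0.

Lemma fitD x v d i : fit x (v + d) i = fit x v i + fit x d i.
Proof.
by rewrite /fit -big_split; apply: eq_bigr => j _; rewrite mxE mulrDl.
Qed.

Lemma fitZ x a v i : fit x (a *: v) i = a * fit x v i.
Proof.
by rewrite /fit mulr_sumr; apply: eq_bigr => j _; rewrite mxE mulrA.
Qed.

Lemma fit_delta x j i : fit x (delta_mx j 0) i = x i j 0.
Proof.
rewrite /fit (bigD1 j) //= mxE !eqxx mul1r big1 ?addr0 // => k kj.
by rewrite mxE (negPf kj) mul0r.
Qed.

(** The loss is quadratic, so its second-order expansion is exact. *)
Lemma lasso_lossD x y v d :
  lasso_loss x y (v + d) = lasso_loss x y v
    - \sum_(k < p) d k 0 * score x y v k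
    + 2^-1 * \sum_(i < N) fit x d i ^+ 2.
Proof.
have -> : \sum_(k < p) d k 0 * score x y v k
        = \sum_(i < N) (y i - fit x v i) * fit x d i.
  transitivity (\sum_(k < p) \sum_(i < N)
      (y i - fit x v i) * (d k 0 * x i k 0)).
    by apply: eq_bigr => k _; rewrite mulr_sumr; apply: eq_bigr => i _; ring.
  by rewrite exchange_big; apply: eq_bigr => i _; rewrite mulr_sumr.
rewrite /lasso_loss !mulr_sumr -sumrB -big_split; apply: eq_bigr => i _ /=.
by rewrite -!/(fit x _ i) fitD; field.
Qed.

(** * Full rank: definiteness and invertibility of the covariance *)

(** If all fits vanish, every data point is orthogonal to (v, 0), hence lies in a hyperplane unless
    v = 0. *)
Lemma full_rank_fit x y v : full_rank x y -> (forall i, fit x v i = 0) -> v = 0.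
Proof.
move=> fr v0; apply/eqP/negP => /negP nz_v; apply: fr.
pose f : 'cV[R]_(p + 1) -> 'cV[R]_1 := mulmx (col_mx v 0)^T.
exists 0, (lker (linfun f)); split.
  (* A full kernel would make (v, 0) orthogonal to itself, so the sum of squares of v would
     vanish. *)
  apply/negP => /eqP kf.
  have : col_mx v 0 \in lker (linfun f) by rewrite kf memvf.
  rewrite memv_ker lfunE /= /f tr_col_mx mul_row_col trmx0 mul0mx addr0.
  move=> /eqP/matrixP/(_ 0 0); rewrite !mxE => /eqP.
  rewrite psumr_eq0 => [/allP v_eq0|j _]; last by rewrite mxE -expr2 sqr_ge0.
  case/eqP: nz_v; apply/matrixP => j k; rewrite ord1 !mxE.
  have := v_eq0 j; rewrite mem_index_enum mxE mulf_eq0 orbb => /(_ isT).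
  by move/eqP.
move=> i; rewrite subr0 memv_ker lfunE /= /f /data_point tr_col_mx mul_row_col.
rewrite trmx0 mul0mx addr0; apply/eqP/matrixP => a b; rewrite !ord1 !mxE.
by rewrite -[RHS](v0 i) /fit; apply: eq_bigr => j _; rewrite mxE.
Qed.

Lemma full_rank_fit_sqr_gt0 x y v :
  full_rank x y -> v != 0 -> 0 < \sum_(i < N) fit x v i ^+ 2.
Proof.
move=> fr nz_v; rewrite lt_neqAle sumr_ge0 ?andbT => [|i _]; last exact: sqr_ge0.
apply: contraNneq nz_v => /esym/eqP.
rewrite psumr_eq0 => [/allP v0|i _]; last exact: sqr_ge0.
apply/eqP; apply: (full_rank_fit fr) => i; apply/eqP; rewrite -sqrf_eq0.
by have := v0 i; rewrite mem_index_enum => /(_ isT).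
Qed.

Lemma covarianceE x j k :
  Defs.covariance x j k = N%:R^-1 * \sum_(i < N) x i j 0 * x i k 0.
Proof.
rewrite /Defs.covariance mxE summxE; congr (_ * _); apply: eq_bigr => i _.
by rewrite mxE big_ord1 mxE.
Qed.

Lemma covariance_mulE x v k :
  (Defs.covariance x *m v) k 0 = N%:R^-1 * \sum_(i < N) fit x v i * x i k 0.
Proof.
rewrite mxE; under eq_bigr => j _ do rewrite covarianceE -mulrA mulr_suml.
rewrite -mulr_sumr exchange_big; congr (_ * _); apply: eq_bigr => i _ /=.
by rewrite mulr_suml; apply: eq_bigr => j _; ring.
Qed.

Lemma full_rank_N_neq0 x y : (0 < p)%N -> full_rank x y -> N%:R != 0 :> R.
Proof.
move=> p_gt0 fr; rewrite pnatr_eq0; apply/negP => /eqP N0.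
have /matrixP/(_ (Ordinal p_gt0) 0) : const_mx 1 = 0 :> 'cV[R]_p.
  by apply: (full_rank_fit fr) => -[m m_lt]; exfalso; rewrite N0 in m_lt.
by rewrite !mxE => /eqP; rewrite oner_eq0.
Qed.

(** If K w = 0, the sum of squared fits of w, which is N w^T K w, vanishes, so w = 0. *)
Lemma covariance_unitmx x y :
  (0 < p)%N -> full_rank x y -> Defs.covariance x \in unitmx.
Proof.
move=> p_gt0 fr; have N0 := full_rank_N_neq0 p_gt0 fr.
rewrite -unitmx_tr -row_free_unit; apply/row_freeP/row_freeP/inj_row_free.
move=> w wK0; have Kw : Defs.covariance x *m w^T = 0.
  by rewrite -[LHS]trmxK trmx_mul trmxK wK0 trmx0.
apply/eqP/negP => /negP nz_w.
have : w^T != 0 by apply: contra nz_w => /eqP w0; rewrite -[w]trmxK w0 trmx0.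
move=> /(full_rank_fit_sqr_gt0 fr); apply/negP; rewrite -leNgt le_eqVlt.
apply/orP; left; apply/eqP.
transitivity (\sum_(k < p) w 0 k * \sum_(i < N) fit x w^T i * x i k 0).
  transitivity (\sum_(i < N) fit x w^T i * fit x w^T i) => //.
  under [RHS]eq_bigr => k _ do rewrite mulr_sumr.
  rewrite [RHS]exchange_big; apply: eq_bigr => i _ /=.
  rewrite {2}/fit mulr_sumr; apply: eq_bigr => k _; rewrite mxE; ring.
apply: big1 => k _; apply/eqP; rewrite mulf_eq0; apply/orP; right.
have := covariance_mulE x w^T k; rewrite Kw mxE => /esym/eqP.
by rewrite mulf_eq0 invr_eq0 (negPf N0).
Qed.

(** * The least-squares point and the active norm constraint *)

Lemma score_beta_hat x y k :
  (0 < p)%N -> full_rank x y -> score x y (beta_hat x y) k = 0.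
Proof.
move=> p_gt0 fr; have N0 := full_rank_N_neq0 p_gt0 fr.
have : Defs.covariance x *m beta_hat x y = response_covariance x y.
  by rewrite /beta_hat mulKVmx // (covariance_unitmx p_gt0 fr).
move=> /matrixP/(_ k 0); rewrite covariance_mulE mxE summxE.
move=> /(mulfI (invr_neq0 N0)) E; rewrite /score.
under eq_bigr => i _ do rewrite mulrBl.
by rewrite sumrB E; apply/eqP; rewrite subr_eq0; apply/eqP/eq_bigr => i _;
  rewrite mxE.
Qed.

Lemma lasso_loss_beta_hatD x y d : (0 < p)%N -> full_rank x y ->
  lasso_loss x y (beta_hat x y + d) =
    lasso_loss x y (beta_hat x y) + 2^-1 * \sum_(i < N) fit x d i ^+ 2.
Proof.
move=> p_gt0 fr; rewrite lasso_lossD big1 ?subr0 // => k _.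
by rewrite score_beta_hat // mulr0.
Qed.

Lemma l1normD v d : l1norm (v + d) <= l1norm v + l1norm d.
Proof.
rewrite /l1norm -big_split; apply: ler_sum => j _; rewrite mxE.
exact: ler_normD.
Qed.

Lemma l1normZ a v : l1norm (a *: v) = `|a| * l1norm v.
Proof.
by rewrite /l1norm mulr_sumr; apply: eq_bigr => j _; rewrite mxE normrM.
Qed.

Lemma l1norm_delta (j : 'I_p) : l1norm (delta_mx j 0 : 'cV[R]_p) = 1.
Proof.
rewrite /l1norm (bigD1 j) //= mxE !eqxx normr1 big1 ?addr0 // => k kj.
by rewrite mxE (negPf kj) normr0.
Qed.

(* If the norm were smaller, moving slightly towards [beta_hat] would stay
   admissible and decrease the loss. *)
Lemma lasso_estimate_l1norm x y t v : (0 < p)%N -> full_rank x y ->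
  t <= t_hat x y -> lasso_estimate x y t v -> l1norm v = t.
Proof.
move=> p_gt0 fr t_le [v_le v_min]; apply/eqP; rewrite eq_le v_le leNgt.
apply/negP => v_lt; pose d := v - beta_hat x y.
have nz_d : d != 0.
  rewrite subr_eq0; apply/eqP => E; move: v_lt.
  by rewrite E -/(t_hat x y) ltNge t_le.
have Q_gt0 := full_rank_fit_sqr_gt0 fr nz_d.
have D_gt0 : 0 < t_hat x y - l1norm v by rewrite subr_gt0 (lt_le_trans v_lt).
(* With this weight, the bound (1 - e) |v| + e [t_hat] on the norm of the convex combination is
   exactly t. *)
pose e := (t - l1norm v) / (t_hat x y - l1norm v).
have e_gt0 : 0 < e by rewrite divr_gt0 // subr_gt0.
have e_le1 : e <= 1 by rewrite ler_pdivrMr // mul1r lerB.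
have eD : e * (t_hat x y - l1norm v) = t - l1norm v.
  by rewrite divfK // gt_eqF.
have := v_min ((1 - e) *: v + e *: beta_hat x y).
have -> : (1 - e) *: v + e *: beta_hat x y = beta_hat x y + (1 - e) *: d.
  apply/matrixP => i k; rewrite !mxE; ring.
have -> : v = beta_hat x y + d by rewrite addrC subrK.
rewrite !lasso_loss_beta_hatD // lerD2l ler_pM2l ?invr_gt0 ?ltr0n //.
under [X in _ -> _ <= X]eq_bigr => i _ do rewrite fitZ exprMn.
rewrite -mulr_sumr; set Q := \sum_(i < N) _ in Q_gt0 *.
have -> : beta_hat x y + (1 - e) *: d = (1 - e) *: v + e *: beta_hat x y.
  apply/matrixP => i k; rewrite !mxE; ring.
move=> H; have {}H : Q <= (1 - e) ^+ 2 * Q.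
  apply: H; apply: (le_trans (l1normD _ _)); rewrite !l1normZ.
  rewrite ger0_norm ?subr_ge0 // ger0_norm ?(ltW e_gt0) // -/(t_hat x y).
  nra.
(* Q - (1 - e)^2 Q = e Q + (1 - e) e Q is positive, against [H]. *)
have eQ_gt0 : 0 < e * Q by rewrite mulr_gt0.
have : 0 <= (1 - e) * (e * Q) by rewrite mulr_ge0 ?subr_ge0 // ltW.
nra.
Qed.

(** * First-order conditions at a minimizer on an axis *)

(** Divide by e and let e tend to 0; an explicit small e replaces the limit. *)
Lemma ler_addr_quadratic (a q c : R) : 0 < c ->
  (forall e, 0 <= e <= c -> e * a <= e ^+ 2 * q) -> a <= 0.
Proof.
move=> c_gt0 H; rewrite leNgt; apply/negP => a_gt0.
have [q_le|q_gt] := leP q 0.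
  have := H c; rewrite lexx ltW // => /(_ isT); nra.
(* For e at most a / (2 q), the quadratic term is at most e a / 2, less than e a. *)
pose e := Num.min c (a / (2 * q)).
have e_gt0 : 0 < e by rewrite lt_min c_gt0 divr_gt0 // mulr_gt0 // ltr0n.
have := H e; rewrite ltW // ge_min lexx /= => /(_ isT).
have : e * (2 * q) <= a.
  by rewrite -ler_pdivlMr ?mulr_gt0 ?ltr0n // ge_min lexx orbT.
rewrite expr2; nra.
Qed.

(** The sum is minus the derivative of the loss along the admissible direction d. *)
Lemma lasso_estimate_direction x y t v d c : lasso_estimate x y t v -> 0 < c ->
  (forall e, 0 <= e <= c -> l1norm (v + e *: d) <= t) ->
  \sum_(k < p) d k 0 * score x y v k <= 0.
Proof.
move=> [_ v_min] c_gt0 d_ok.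
apply: (ler_addr_quadratic (q := 2^-1 * \sum_(i < N) fit x d i ^+ 2) c_gt0).
move=> e /d_ok/v_min; rewrite lasso_lossD.
under eq_bigr => k _ do rewrite mxE -mulrA.
under [X in _ <= _ + _ * X]eq_bigr => i _ do rewrite fitZ exprMn.
rewrite -!mulr_sumr; nra.
Qed.

Lemma sum_delta (F : 'I_p -> R) j : \sum_(k < p) (k == j)%:R * F k = F j.
Proof.
rewrite (bigD1 j) //= eqxx mul1r big1 ?addr0 // => k kj.
by rewrite (negPf kj) mul0r.
Qed.

(** Transferring mass e from coordinate j to coordinate k, with either sign a, keeps the norm at
    most t; the first-order conditions for both signs bound |r_k|. *)
Lemma lasso_estimate_axis_score x y t s j k : 0 < t -> `|s| = 1 ->
  lasso_estimate x y t ((t * s) *: delta_mx j 0) ->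
  `|score x y ((t * s) *: delta_mx j 0) k|
    <= s * score x y ((t * s) *: delta_mx j 0) j.
Proof.
set v := _ *: _ => t_gt0 s1 v_est.
have dir a : `|a| = 1 -> a * score x y v k <= s * score x y v j.
  move=> a1; rewrite -subr_le0.
  have := @lasso_estimate_direction x y t v
    (a *: delta_mx k 0 - s *: delta_mx j 0) t v_est t_gt0.
  under [X in _ -> X <= 0]eq_bigr => l _ do
    rewrite !mxE eqxx !andbT mulrBl -!mulrA.
  rewrite sumrB -!mulr_sumr !sum_delta; apply=> e /andP[e_ge0 e_le].
  have -> : v + e *: (a *: delta_mx k 0 - s *: delta_mx j 0) =
      ((t - e) * s) *: delta_mx j 0 + (e * a) *: delta_mx k 0.
    by apply/matrixP => i l; rewrite !mxE; ring.
  rewrite (le_trans (l1normD _ _)) // !l1normZ !l1norm_delta !mulr1 !normrM.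
  by rewrite a1 s1 !mulr1 !ger0_norm ?subr_ge0 // subrK.
rewrite ler_norml -lerNl -mulN1r -{2}[score x y v k]mul1r.
by rewrite !dir ?normrN1 ?normr1.
Qed.

(** * Scores along an axis for normalized data *)

Lemma scoreD x y v d k :
  score x y (v + d) k = score x y v k - \sum_(i < N) fit x d i * x i k 0.
Proof.
by rewrite /score -sumrB; apply: eq_bigr => i _; rewrite fitD; ring.
Qed.

Lemma normalized_sum_sqr x j : normalized x -> \sum_(i < N) x i j 0 ^+ 2 = N%:R.
Proof.
move=> /(_ j); rewrite covarianceE => x1.
(* The inverse of 0 is 0, so N = 0 would give diagonal entries 0 instead of 1. *)
have N0 : N%:R != 0 :> R.
  by apply/eqP => N0; move/eqP: x1; rewrite N0 invr0 mul0r eq_sym oner_eq0.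
by rewrite -[RHS]mulr1 -[X in _ = _ * X]x1 mulVKf //; apply: eq_bigr => i _; rewrite expr2.
Qed.

(** Cauchy-Schwarz for two vectors of squared norm N, read off from the squares of their sum and
    difference. *)
Lemma normalized_cross_le x j k :
  normalized x -> `|\sum_(i < N) x i j 0 * x i k 0| <= N%:R.
Proof.
move=> x1; have := normalized_sum_sqr j x1; have := normalized_sum_sqr k x1.
have : 0 <= \sum_(i < N) (x i j 0 - x i k 0) ^+ 2.
  by apply: sumr_ge0 => i _; exact: sqr_ge0.
have : 0 <= \sum_(i < N) (x i j 0 + x i k 0) ^+ 2.
  by apply: sumr_ge0 => i _; exact: sqr_ge0.
under eq_bigr => i _ do rewrite sqrrD.
under [X in _ -> 0 <= X -> _]eq_bigr => i _ do rewrite sqrrB.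
rewrite !big_split /= sumrN !sumrMnl.
move=> ? ? ? ?; rewrite ler_norml; apply/andP; split; lra.
Qed.

(* Moving from [t0] back to [t] changes each score by at most [(t0 - t) N], as
   correlations are at most 1, and raises [s * score j] by exactly that. *)
Lemma axis_score_le x y s t t0 j k : normalized x -> `|s| = 1 -> t <= t0 ->
  `|score x y ((t0 * s) *: delta_mx j 0) k|
    <= s * score x y ((t0 * s) *: delta_mx j 0) j ->
  `|score x y ((t * s) *: delta_mx j 0) k|
    <= s * score x y ((t * s) *: delta_mx j 0) j.
Proof.
move=> x1 s1 t_le H.
have sE l : score x y ((t * s) *: delta_mx j 0) l =
    score x y ((t0 * s) *: delta_mx j 0) l +
    (t0 - t) * s * \sum_(i < N) x i j 0 * x i l 0.
  have -> : (t * s) *: delta_mx j 0 =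
      (t0 * s) *: delta_mx j 0 - ((t0 - t) * s) *: delta_mx j 0 :> 'cV[R]_p.
    by apply/matrixP => a b; rewrite !mxE; ring.
  rewrite -scaleNr scoreD mulr_sumr -sumrN; congr (_ + _).
  by apply: eq_bigr => i _; rewrite fitZ fit_delta; ring.
have ss : s * s = 1 by rewrite -expr2 -real_normK ?num_real // s1 expr1n.
rewrite !sE (le_trans (ler_normD _ _)) // mulrDr lerD //.
rewrite normrM normrM s1 mulr1 ger0_norm ?subr_ge0 //.
under [X in _ <= s * (_ * X)]eq_bigr => i _ do rewrite -expr2.
rewrite normalized_sum_sqr // mulrA [s * _]mulrCA ss mulr1.
by rewrite ler_wpM2l ?subr_ge0 // normalized_cross_le.
Qed.

(** * The path and its segments on an axis *)

(** Let v be the axis point and r its score. By duality of the l1 and sup norms, r pairs with w to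
    at most t s r_j, its pairing with v. So the loss at w exceeds that at v by at least half the sum
    of squared fits of w - v, which is positive unless w = v. *)
Lemma lasso_estimate_axis_unique x y s t j w : full_rank x y -> `|s| = 1 ->
  0 <= t ->
  (forall k, `|score x y ((t * s) *: delta_mx j 0) k|
    <= s * score x y ((t * s) *: delta_mx j 0) j) ->
  lasso_estimate x y t w -> w = (t * s) *: delta_mx j 0.
Proof.
set v := _ *: _ => fr s1 t_ge0 sc [w_le w_min].
apply/eqP; rewrite -subr_eq0; apply: contraT => /(full_rank_fit_sqr_gt0 fr) Q_gt0.
have := w_min v; rewrite l1normZ l1norm_delta mulr1 normrM s1 mulr1 ger0_norm //.
move=> /(_ (lexx _)); rewrite -{1}[w](subrKC v) lasso_lossD.
under eq_bigr => k _ do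
  rewrite mxE [(- v) _ _]mxE [v _ _]mxE mxE eqxx andbT mulrBl
    -[t * s * _ * _]mulrA.
rewrite sumrB -mulr_sumr sum_delta.
(* This sign allows |w| to be replaced by its bound t. *)
have l_ge0 : 0 <= s * score x y v j := le_trans (normr_ge0 _) (sc j).
have : \sum_(k < p) w k 0 * score x y v k <= l1norm w * (s * score x y v j).
  rewrite /l1norm mulr_suml; apply: ler_sum => k _.
  by rewrite (le_trans (ler_norm _)) // normrM ler_wpM2l.
nra.
Qed.

Lemma lasso_path_axis_ray x y beta t0 j : (0 < p)%N -> full_rank x y ->
  normalized x -> lasso_path x y beta -> 0 < t0 <= t_hat x y ->
  coordinate_axis j (beta t0) ->
  forall t, 0 <= t <= t0 -> beta t = (t / t0) *: beta t0.
Proof.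
move=> p_gt0 fr x1 path /andP[t0_gt0 t0_le] ax t /andP[t_ge0 t_le].
have est0 : lasso_estimate x y t0 (beta t0) by apply: path; rewrite ltW.
have bE : beta t0 = beta t0 j 0 *: delta_mx j 0.
  apply/matrixP => k l; rewrite ord1 !mxE eqxx andbT.
  have [->|kj] := eqVneq k j; first by rewrite mulr1.
  by rewrite mulr0 ax.
have nb : `|beta t0 j 0| = t0.
  have := lasso_estimate_l1norm p_gt0 fr t0_le est0.
  by rewrite {1}bE l1normZ l1norm_delta mulr1.
pose s := beta t0 j 0 / t0.
have s1 : `|s| = 1 by rewrite normrM nb ger0_norm ?invr_ge0 ?ltW // divff ?gt_eqF.
have {}bE : beta t0 = (t0 * s) *: delta_mx j 0.
  by rewrite {1}bE /s mulrCA divff ?mulr1 // gt_eqF.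
rewrite bE scalerA mulrA divfK ?gt_eqF //.
apply: (lasso_estimate_axis_unique fr s1 t_ge0) => [k|]; last first.
  by apply: path; rewrite t_ge0 (le_trans t_le).
apply: (axis_score_le x1 s1 t_le); apply: lasso_estimate_axis_score => //.
by rewrite -bE.
Qed.

Lemma segment_on_axis_ray x y beta (I : set R) : (0 < p)%N -> full_rank x y ->
  normalized x -> lasso_path x y beta ->
  constant_sign_portion x y beta I ->
  (forall J, constant_sign_portion x y beta J -> I `<=` J -> J = I) ->
  (exists u v, [/\ (beta @` I) u, (beta @` I) v & u <> v]) ->
  on_coordinate_axis (beta @` I) ->
  exists2 t0, 0 < t0 & forall t, 0 < t <= t0 ->
    I t /\ beta t = (t / t0) *: beta t0.
Proof.
move=> p_gt0 fr x1 path [I_sub I_itv I_sgn] I_max [u [v [Su Sv uv]]] [j ax].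
(* Distinct points come from distinct parameters, at most one of which is 0. *)
have [t0 It0 t0_gt0] : exists2 t, I t & 0 < t.
  case: Su => s Is su; case: Sv => t It tv.
  have s_ge0 : 0 <= s by move/I_sub: Is; rewrite /= in_itv => /andP[].
  have t_ge0 : 0 <= t by move/I_sub: It; rewrite /= in_itv => /andP[].
  have [s0|s_neq0] := eqVneq s 0; last by exists s; rewrite // lt_def s_neq0.
  exists t => //; rewrite lt_def t_ge0 andbT; apply/eqP => t0.
  by apply: uv; rewrite -su -tv s0 t0.
have t0_le : t0 <= t_hat x y by move/I_sub: It0; rewrite /= in_itv => /andP[].
have ray t : 0 <= t <= t0 -> beta t = (t / t0) *: beta t0.
  apply: (@lasso_path_axis_ray x y beta t0 j) => //; first by rewrite t0_gt0 t0_le.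
  by apply: ax; exists t0.
exists t0 => // t /andP[t_gt0 t_le].
split; last by apply: ray; rewrite ltW.
(* On ]0, t0] the path is a positive multiple of [beta t0], so the signs agree; 0 is left out
   because all signs vanish there. *)
pose J : set R := I `|` [set` `]0, t0]].
suff <- : J = I by right; rewrite /= in_itv /= t_gt0.
have sgnJ s : J s -> sign_vector (beta s) = sign_vector (beta t0).
  case=> [Is|]; first exact: I_sgn.
  rewrite /= in_itv => /andP[s_gt0 s_le]; rewrite ray ?(ltW s_gt0) //.
  by apply/matrixP => a b; rewrite !mxE sgrM gtr0_sg ?mul1r // divr_gt0.
apply: I_max; last by move=> s; left.
split.
- move=> s [/I_sub//|]; rewrite /= !in_itv => /andP[s_gt0 s_le] /=.
  by rewrite ltW // (le_trans s_le).
(* The two intervals share t0, so their union has no gap. *)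
- move=> a b Ja Jb c /andP[ac cb].
  have [c_le|c_gt] := leP c t0.
    case: Ja => [Ia|]; last first.
      rewrite /= in_itv => /andP[a_gt0 _]; right.
      by rewrite /= in_itv /= c_le (lt_le_trans a_gt0).
    by left; apply: (I_itv a t0) => //; rewrite ac.
  left; apply: (I_itv t0 b) => //; last by rewrite cb ltW.
  case: Jb => //; rewrite /= in_itv => /andP[_ b_le].
  by have := lt_le_trans c_gt (le_trans cb b_le); rewrite ltxx.
- by move=> a b /sgnJ -> /sgnJ ->.
Qed.

End LassoTheory.

(** * The origin in the closure, and uniqueness of the segment *)

Theorem proposition5p2 (R : realType) (N p : nat)
    (x : 'I_N -> 'cV[R]_p) (y : 'I_N -> R) (beta : R -> 'cV[R]_p)
    (p_ge2 : (2 <= p)%N)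
    (xy_centered : centered x y) (xy_full_rank : full_rank x y)
    (x_normalized : normalized x)
    (beta_path : lasso_path x y beta) :
  (forall S : set 'cV[R]_p,
     lasso_segment x y beta S -> on_coordinate_axis S -> closure S 0) /\
  (forall S S' : set 'cV[R]_p,
     lasso_segment x y beta S -> on_coordinate_axis S ->
     lasso_segment x y beta S' -> on_coordinate_axis S' -> S = S').
Proof.
have p_gt0 : (0 < p)%N by exact: ltnW.
split=> [S [I [cI mI -> lI]] ax|
         S S' [I [cI mI -> lI]] ax [J [cJ mJ -> lJ]] ax'].
  have [t0 t0_gt0 ray] := segment_on_axis_ray p_gt0 xy_full_rank x_normalized
    beta_path cI mI lI ax.
  have cvg0 : (t / t0) *: beta t0 @[t --> 0^'+] --> (0 : 'cV[R]_p).
    rewrite -[X in _ --> X](scale0r (beta t0)) -[X in X *: _](mul0r t0^-1).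
    by apply: cvgZr_tmp; apply: cvgMr_tmp; exact: cvg_at_right_filter.
  (* The limit stays in the closure because the ray lies in S for small t > 0. *)
  apply: (closed_cvg _ (@closed_closure _ _) _ _ cvg0).
  near=> t; have [|It <-] := ray t; last by apply: subset_closure; exists t.
  by apply/andP; split; near: t; [exact: nbhs_right_gt|exact: nbhs_right_le].
have [t1 t1_gt0 ray1] := segment_on_axis_ray p_gt0 xy_full_rank x_normalized
  beta_path cI mI lI ax.
have [t2 t2_gt0 ray2] := segment_on_axis_ray p_gt0 xy_full_rank x_normalized
  beta_path cJ mJ lJ ax'.
(* Whichever axes the segments lie on, both parameter sets contain ]0, m]. *)
pose m := Num.min t1 t2.
have m_gt0 : 0 < m by rewrite lt_min t1_gt0.
have Im : I m by apply: (ray1 m _).1; rewrite m_gt0 ge_min lexx.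
have Jm : J m by apply: (ray2 m _).1; rewrite m_gt0 ge_min lexx orbT.
(* By maximality, the union then equals each of the two sets. *)
suff cIJ : constant_sign_portion x y beta (I `|` J).
  have IE : I `|` J = I by apply: mI => // t; left.
  have JE : I `|` J = J by apply: mJ => // t; right.
  by rewrite -{1}IE JE.
case: cI cJ => [I_sub I_itv I_sgn] [J_sub J_itv J_sgn].
have sgnIJ s : (I `|` J) s -> sign_vector (beta s) = sign_vector (beta m).
  by case=> [Is|Js]; [exact: I_sgn|exact: J_sgn].
split; first by rewrite subUset.
- move=> a b Ka Kb c /andP[ac cb]; have [cm|mc] := leP c m.
    case: Ka => [Ia|Ja]; first by left; apply: (I_itv a m) => //; rewrite ac.
    by right; apply: (J_itv a m) => //; rewrite ac.
  case: Kb => [Ib|Jb]; first by left; apply: (I_itv m b) => //; rewrite ltW.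
  by right; apply: (J_itv m b) => //; rewrite ltW.
- by move=> a b /sgnIJ -> /sgnIJ ->.
Unshelve. all: by end_near.
Qed.
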